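(* Let $(p_j)_{j\ge 1}$ satisfy $0\le p_j<1$ for all $j$, $0<p_1<1$, and $\sum_{k=1}^\infty (1-p_1)\cdots(1-p_k)<\infty$. In the random directed line graph on $\mathbb{Z}$ with connection probabilities $(p_j)$, for every $i\in\mathbb{Z}$, almost surely there is a path from $i$ to $j$ for all sufficiently large $j$.
   Context: Random directed line graph: for each pair of integers $i<j$, independently over pairs, the directed edge $(i,j)$ is present with probability $p_{j-i}$. A path from $i$ to $j$ is an increasing sequence $i=i_0<i_1<\cdots<i_\ell=j$ of integers with every $(i_{s-1},i_s)$ an edge. *)

(* Defs.v *)
From HB Require Import structures.
From mathcomp Require Import all_boot all_order all_algebra finmap.
From mathcomp Require Import all_classical all_reals all_analysis.

Set Implicit Arguments.
Unset Strict Implicit.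
Unset Printing Implicit Defensive.
Import Order.TTheory GRing.Theory Num.Theory.
Local Open Scope classical_set_scope.
Local Open Scope ring_scope.

Definition mutually_independent (R : realType) (d : measure_display)
    (T : measurableType d) (P : probability T R) (I : choiceType)
    (D : set I) (E : I -> set T) : Prop :=
  (forall i, D i -> measurable (E i)) /\
  forall J : {fset I}, [set` J] `<=` D ->
    P (\bigcap_(i in [set` J]) E i) = (\prod_(i <- J) P (E i))%E.

(* [G w] is the edge relation of the sample [w]. Only its values on pairs
   (i, j) with i < j are constrained or used; for those, `|j - i|%N = j - i.
   Likewise [p 0] is never used. *)
Definition random_line_graph (R : realType) (d : measure_display)
    (T : measurableType d) (P : probability T R) (p : nat -> R)
    (G : T -> rel int) : Prop :=
  mutually_independent P [set e : int * int | e.1 < e.2]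
    (fun e => [set w | G w e.1 e.2]) /\
  forall i j : int, i < j -> P [set w | G w i j] = (p `|j - i|%N)%:E.

(* [s] lists the vertices i_1, ..., i_l that follow i_0 = i. *)
Definition increasing_path (g : rel int) (i j : int) (s : seq int) : bool :=
  path (fun a b => (a < b) && g a b) i s && (last i s == j).

(* Main.v *)
(* Write q_k = (1 - p_1) ... (1 - p_k). Given that i + 1, ..., i + n are all
   reached from i, the vertex i + n + 1 is missed with probability q_(n+1), so
   with probability at least c = prod_k (1 - q_k) > 0, the same for all i, every
   vertex beyond i is reached. If instead i misses infinitely many vertices, let
   i + m be the first vertex that is reached after a miss; it exists almost
   surely because q_k -> 0 gives i infinitely many direct edges. Then i + m also
   misses infinitely many vertices. The choice of m depends only on edges within
   [i, i + m], and the misses of i + m only on edges to its right, so by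
   independence the probability b_i of infinitely many misses satisfies
   b_i <= (1 - c) sup_j b_j. Hence b_i <= (1 - c)^k for all k. *)

Require Import Defs.
From mathcomp Require Import all_boot all_order all_algebra finmap lra zify.
From mathcomp Require Import all_classical all_reals all_analysis.
Set Implicit Arguments.
Unset Strict Implicit.
Unset Printing Implicit Defensive.
Import Order.TTheory GRing.Theory Num.Theory.
Import numFieldNormedType.Exports.
Local Open Scope classical_set_scope.
Local Open Scope ring_scope.

(** * Weierstrass product inequality and positivity of infinite products *)

Lemma prod_one_minus_ge (R : realFieldType) (u : nat -> R) (m n : nat) :
  (forall k, 0 <= u k <= 1) ->
  1 - \sum_(m <= k < n) u k <= \prod_(m <= k < n) (1 - u k).
Proof.
move=> u01; elim: n => [|n IHn]; first by rewrite !big_geq// subr0.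
have [nm|mn] := ltnP n m; first by rewrite !big_geq// subr0.
rewrite !big_nat_recr//=.
have /andP[u0 u1] := u01 n.
have P1 : \prod_(m <= k < n) (1 - u k) <= 1.
  by apply: prodr_ile1 => k _; have := u01 k; lra.
nra.
Qed.

Lemma bounded_series_cvg (R : realType) (u : nat -> R) (M : R) :
  (forall k, 0 <= u k) -> (forall n, \sum_(0 <= k < n) u k <= M) ->
  nondecreasing_seq (series u) /\ cvgn (series u).
Proof.
move=> u0 uM.
have nd : nondecreasing_seq (series u).
  by apply/nondecreasing_seqP => n; rewrite /series/= big_nat_recr//= lerDl.
split=> //; apply: nondecreasing_is_cvgn => //.
by exists M => _ [n _ <-]; exact: uM.
Qed.

(** Once the tail of the series is below 1/2, the Weierstrass inequality keeps the tail product
    above 1/2. The finitely many earlier factors are positive because [u k < 1]. *)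
Lemma prod_one_minus_bounded_away (R : realType) (u : nat -> R) (M : R) :
  (forall k, 0 <= u k < 1) ->
  (forall n, \sum_(0 <= k < n) u k <= M) ->
  exists2 c : R, 0 < c & forall n, c <= \prod_(0 <= k < n) (1 - u k).
Proof.
move=> u01 uM.
have u0 k : 0 <= u k by case/andP: (u01 k).
have u1 k : 0 <= u k <= 1 by have := u01 k; lra.
have [nd cu] := bounded_series_cvg u0 uM.
have [N _ HN] : \forall n \near \oo, limn (series u) - 2^-1 < series u n.
  by apply: cvgr_gt cu _ _; rewrite ltrBlDr ltrDl invr_gt0.
have P0 n m : 0 < \prod_(n <= k < m) (1 - u k).
  by apply: prodr_gt0 => k _; have := u01 k; lra.
have tail n : (N <= n)%N -> 2^-1 <= \prod_(N <= k < n) (1 - u k).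
  move=> Nn; apply: le_trans (@prod_one_minus_ge _ _ N n u1).
  have := HN N (leqnn N); have := nondecreasing_cvgn_le nd cu n.
  rewrite /series/= (@big_cat_nat _ _ _ N 0%N n)//=; lra.
exists (\prod_(0 <= k < N) (1 - u k) * 2^-1).
  by rewrite mulr_gt0// invr_gt0.
move=> n; have [Nn|/ltnW nN] := leqP N n.
  by rewrite (@big_cat_nat _ _ _ N 0%N n)//= ler_pM2l// tail.
(* For [n < N] the product up to [n] dominates the one up to [N], as the missing factors are at most
   1. *)
rewrite (@big_cat_nat _ _ _ n 0%N N)//= -mulrA ler_piMr//; first exact: ltW.
have : \prod_(n <= k < N) (1 - u k) <= 1.
  by apply: prodr_ile1 => k _; have := u1 k; lra.
lra.
Qed.

(** * Independence of two events and Dynkin's theorem *)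

Section independence.
Context {R : realType} {d : measure_display} {T : measurableType d}.
Variable P : probability T R.

Definition independent_events (A B : set T) : Prop :=
  P (A `&` B) = (P A * P B)%E.

Lemma independent_events_sym (A B : set T) :
  independent_events A B -> independent_events B A.
Proof. by rewrite /independent_events setIC muleC. Qed.

Lemma independent_events_setC (A B : set T) :
  measurable A -> measurable B ->
  independent_events A B -> independent_events A (~` B).
Proof.
move=> mA mB AB; rewrite /independent_events.
have PA : P A \is a fin_num by exact: fin_num_measure.
have PB : P B \is a fin_num by exact: fin_num_measure.
have PD : P (A `\` B) = (P A - P (A `&` B))%E by rewrite measureD// ltey_eq PA.
rewrite -setDE PD AB probability_setC//.
rewrite -(fineK PA) -(fineK PB) -EFinM -!EFinB -EFinM.
by rewrite mulrBr mulr1.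
Qed.

Lemma independent_events_bigcup (A : set T) (F : (set T)^nat) :
  measurable A -> (forall k, measurable (F k)) -> trivIset setT F ->
  (forall k, independent_events A (F k)) ->
  independent_events A (\bigcup_k F k).
Proof.
move=> mA mF tF AF; rewrite /independent_events setI_bigcupr.
rewrite !measure_bigcup//; last 2 first.
- by move=> k _; exact: measurableI.
- by apply: trivIset_setIl.
have PA : P A \is a fin_num by exact: fin_num_measure.
rewrite -(fineK PA) -nneseriesZl//.
by apply: eq_eseriesr => k _; rewrite fineK//; exact: AF.
Qed.

(** The measurable events independent of [A] form a Dynkin system, and a Dynkin system containing a
    pi-system contains the sigma-algebra it generates. *)
Lemma independent_events_sigma (A : set T) (C : set (set T)) :
  measurable A -> setI_closed C -> C `<=` measurable ->
  C `<=` independent_events A -> <<s C >> `<=` independent_events A.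
Proof.
move=> mA CI mC AC.
rewrite -setI_closed_g_dynkin_g_sigma_algebra//.
suff : <<d C >> `<=` [set B | measurable B /\ independent_events A B].
  by move=> sub B /sub[].
apply: smallest_sub; last by move=> B CB; split; [exact: mC|exact: AC].
split.
- split; first exact: measurableT.
  by rewrite /independent_events setIT probability_setT mule1.
- move=> B [mB AB]; split; first exact: measurableC.
  exact: independent_events_setC.
- move=> F tF mAF; split; first by apply: bigcupT_measurable => k; case: (mAF k).
  by apply: independent_events_bigcup => // k; case: (mAF k).
Qed.

End independence.

(** * Sigma-algebras generated by disjoint groups of independent events *)

Section grouping.
Context {R : realType} {d : measure_display} {T : measurableType d}.
Variables (P : probability T R) (I : choiceType) (E : I -> set T).

(* Generating the sigma-algebra of the [E i], i in D, by their finite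
   intersections gives a pi-system, as Dynkin's theorem requires. *)
Definition finite_intersections (D : set I) : set (set T) :=
  [set S | exists2 J : {fset I}, [set` J] `<=` D & S = \bigcap_(i in [set` J]) E i].

Definition events_over (D : set I) : set (set T) :=
  (finite_intersections D).-sigma.-measurable.

Lemma finite_intersections_setI (D : set I) :
  setI_closed (finite_intersections D).
Proof.
move=> _ _ [J JD ->] [K KD ->]; exists (J `|` K)%fset.
  by rewrite set_fsetU => i [/JD|/KD].
by rewrite set_fsetU bigcap_setU.
Qed.

Lemma events_over_event (D : set I) (i : I) : D i -> events_over D (E i).
Proof.
move=> Di; apply: sub_sigma_algebra; exists [fset i]%fset.
  by rewrite set_fset1 => _ ->.
by rewrite set_fset1 bigcap_set1.
Qed.

Lemma events_over_sub (D D' : set I) :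
  D `<=` D' -> events_over D `<=` events_over D'.
Proof.
move=> DD'; apply: sub_sigma_algebra2 => S [J JD ->].
by exists J => //; exact: subset_trans DD'.
Qed.

Section closure.
Variable D : set I.
Let sigma : measurableType _ := g_sigma_algebraType (finite_intersections D).

Lemma events_overT : events_over D setT.
Proof. exact: (@measurableT _ sigma). Qed.

Lemma events_overC A : events_over D A -> events_over D (~` A).
Proof. exact: (@measurableC _ sigma). Qed.

Lemma events_overI A B :
  events_over D A -> events_over D B -> events_over D (A `&` B).
Proof. exact: (@measurableI _ sigma). Qed.

Lemma events_overD A B :
  events_over D A -> events_over D B -> events_over D (A `\` B).
Proof. exact: (@measurableD _ sigma). Qed.

Lemma events_over_bigcup (Q : set nat) (F : nat -> set T) :
  (forall k, Q k -> events_over D (F k)) ->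
  events_over D (\bigcup_(k in Q) F k).
Proof. exact: (@bigcup_measurable _ sigma). Qed.

Lemma events_over_bigcap (Q : set nat) (F : nat -> set T) :
  (forall k, Q k -> events_over D (F k)) ->
  events_over D (\bigcap_(k in Q) F k).
Proof. exact: (@bigcap_measurableType _ sigma). Qed.

End closure.

Variable D : set I.
Hypothesis E_indep : mutually_independent P D E.

Lemma events_over_measurable (D' : set I) :
  D' `<=` D -> events_over D' `<=` @measurable _ T.
Proof.
move=> D'D; apply: smallest_sub; first exact: sigma_algebra_measurable.
move=> _ [J JD ->]; apply: fin_bigcap_measurable => // i Ji.
by apply: E_indep.1; apply: D'D; exact: JD.
Qed.

(** Dynkin's theorem is applied to one side at a time, which leaves two finite intersections over
    disjoint index sets. There mutual independence over the union of the index sets gives the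
    product. *)
Lemma events_over_disjoint_independent (D1 D2 : set I) (A B : set T) :
  D1 `<=` D -> D2 `<=` D -> D1 `&` D2 = set0 ->
  events_over D1 A -> events_over D2 B -> independent_events P A B.
Proof.
move=> D1D D2D D12 A1 B2.
have sub D' : D' `<=` D -> finite_intersections D' `<=` @measurable _ T.
  move=> /events_over_measurable D'D S SD'.
  by apply: D'D; exact: sub_sigma_algebra.
apply: (@independent_events_sigma _ _ _ P _ (finite_intersections D2)) => //.
- exact: events_over_measurable A1.
- exact: finite_intersections_setI.
- exact: sub.
move=> C C2; apply: independent_events_sym.
apply: (@independent_events_sigma _ _ _ P _ (finite_intersections D1)) => //.
- exact: sub C2.
- exact: finite_intersections_setI.
- exact: sub.
case: C2 => K K2 -> _ [J J1 ->]; apply: independent_events_sym.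
rewrite /independent_events.
have JK : [disjoint J & K]%fset.
  apply/fdisjointP => i iJ; apply/negP => iK.
  by suff : set0 i by []; rewrite -D12; split; [exact: J1|exact: K2].
have prodE L : [set` L] `<=` D -> P (\bigcap_(i in [set` L]) E i) = _ :=
  E_indep.2 L.
rewrite -bigcap_setU -set_fsetU !prodE; last 3 first.
- exact: subset_trans D2D.
- exact: subset_trans D1D.
- rewrite set_fsetU => i [/J1/D1D//|/K2/D2D//].
rewrite -big_cat; apply: perm_big; apply: uniq_perm.
- exact: fset_uniq.
- rewrite cat_uniq !fset_uniq andbT/=; apply/hasPn => i iK.
  by apply: contraTN iK => iJ; exact: (fdisjointP JK).
- by move=> i; rewrite mem_cat inE.
Qed.

End grouping.

Lemma bigcap_ltn_recr (T : Type) (F : nat -> set T) (n : nat) :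
  \bigcap_(k < n.+1) F k = \bigcap_(k < n) F k `&` F n.
Proof. by rewrite !bigcap_mkord big_ord_recr. Qed.

(** Injectivity of [f] puts [f n] outside the earlier indices, so the grouping lemma splits off one
    factor at a time. *)
Lemma probability_bigcap_setC (R : realType) (d : measure_display)
    (T : measurableType d) (P : probability T R) (I : choiceType)
    (E : I -> set T) (D : set I) (f : nat -> I) (r : nat -> R) (n : nat) :
  mutually_independent P D E -> injective f ->
  (forall k, (k < n)%N -> D (f k) /\ P (E (f k)) = (r k)%:E) ->
  P (\bigcap_(k < n) ~` E (f k)) = (\prod_(0 <= k < n) (1 - r k))%:E.
Proof.
move=> indepE f_inj; elim: n => [|n IHn] Df.
  by rewrite big_geq// bigcap_mkord big_ord0 probability_setT.
have [Dfn Pfn] := Df n (ltnSn n).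
have Df' k : (k < n)%N -> D (f k) by move=> kn; apply: (Df k (ltnW _)).1.
rewrite bigcap_ltn_recr big_nat_recr//= EFinM.
rewrite -IHn => [|k kn]; last exact/Df/ltnW.
rewrite EFinB -Pfn -probability_setC; last exact: indepE.1.
apply: (@events_over_disjoint_independent _ _ _ P _ E _ indepE
  (f @` `I_n) [set f n]) => //.
- by move=> _ [k kn <-]; exact: Df'.
- by move=> _ ->.
- rewrite -subset0 => _ [[k /= kn <-] /f_inj kE]; by rewrite kE ltnn in kn.
- apply: events_over_bigcap.
  by move=> k kn; apply: events_overC; apply: events_over_event; exists k.
- by apply: events_overC; apply: events_over_event.
Qed.

(** * Paths in a fixed graph *)

Section reachability.
Variable g : rel int.
Implicit Types (i j k : int) (s t : seq int).

Definition reachable i j : Prop := exists s, increasing_path g i j s.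

Lemma increasing_path_le i j s : increasing_path g i j s -> i <= j.
Proof.
move=> /andP[+ /eqP <-]; elim: s i => //= a s IHs i /andP[/andP[ia _]] /IHs.
by apply: le_trans; exact: ltW.
Qed.

Lemma reachable_trans j i k : reachable i j -> reachable j k -> reachable i k.
Proof.
move=> [s /andP[ps /eqP sj]] [t /andP[pt tk]]; exists (s ++ t).
by rewrite /increasing_path cat_path last_cat sj ps pt.
Qed.

Lemma reachable_last_edge i j : i < j ->
  reachable i j <-> exists k, [/\ i <= k < j, reachable i k & g k j].
Proof.
move=> ij; split=> [[s]|[k [/andP[ik kj] rik gkj]]]; last first.
  apply: reachable_trans rik _; exists [:: j].
  by rewrite /increasing_path/= kj gkj eqxx.
case/lastP: s => [|s j'] /andP[]; first by move=> _ /eqP/= ijE; rewrite ijE ltxx in ij.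
rewrite rcons_path last_rcons => /andP[ps /andP[sj gsj]] /eqP j'E; subst j'.
have is_ : increasing_path g i (last i s) s by rewrite /increasing_path ps eqxx.
exists (last i s); split=> //; last by exists s.
by rewrite sj (increasing_path_le is_).
Qed.

End reachability.

(** This is q_k, the probability that a vertex has no edge from any of the k vertices just before
    it, and equally that it has none to the k just after it. *)
Definition no_edge_probability (R : realType) (p : nat -> R) (k : nat) : R :=
  \prod_(1 <= j < k.+1) (1 - p j).

(** * Reachability events of the random graph and their probabilities *)

Section line_graph.
Context {R : realType} {d : measure_display} {T : measurableType d}.
Variables (P : probability T R) (p : nat -> R) (G : T -> rel int).
Hypothesis G_graph : random_line_graph P p G.
Implicit Types (i : int) (n m k : nat).

Let edges : set (int * int) := [set e | e.1 < e.2].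
Let edge (e : int * int) : set T := [set w | G w e.1 e.2].
(** These sets record which edges an event depends on. [edges_within i m] is disjoint from
    [edges_from (i + m%:Z)], whence the independence used when restarting at i + m. *)
Let edges_within i n : set (int * int) :=
  [set e | i <= e.1 /\ e.1 < e.2 <= i + n%:Z].
Let edges_from i : set (int * int) := [set e | i <= e.1 < e.2].

Definition reach i n : set T := [set w | reachable (G w) i (i + n%:Z)].

Lemma reach0 i : reach i 0 = setT.
Proof.
by apply/seteqP; split=> // w _; exists [::]; rewrite /increasing_path/= addr0.
Qed.

Lemma reachE i n : (0 < n)%N ->
  reach i n = \bigcup_(k < n) (reach i k `&` edge (i + k%:Z, i + n%:Z)).
Proof.
move=> n0; apply/seteqP; split=> w.
- move=> /reachable_last_edge[|k [ikn rk gk]]; first by lia.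
  have [m mE] : exists m : nat, k = i + m%:Z by exists `|k - i|%N; lia.
  by exists m => /=; [lia|rewrite /reach/= -mE].
- move=> [k /= kn [rk gk]]; apply/reachable_last_edge; first by lia.
  by exists (i + k%:Z); split=> //; lia.
Qed.

Lemma reach_trans i m n : reach i m `&` reach (i + m%:Z) n `<=` reach i (m + n).
Proof.
by move=> w [im]; rewrite /reach/= PoszD addrA; exact: reachable_trans.
Qed.

(** By strong induction: [reachE] expresses the event through earlier targets and single edges into
    i + n, all inside the window. *)
Lemma reach_events_over i n : events_over edge (edges_within i n) (reach i n).
Proof.
have [m] := ubnP n; elim: m n => // m IHm n nm.
have [->|n0] := posnP n.
  by rewrite reach0; exact: events_overT.
rewrite reachE//.
apply: events_over_bigcup => k /= kn.
apply: events_overI.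
  apply: (@events_over_sub _ _ _ edge (edges_within i k)); last by apply: IHm; lia.
  by move=> e []; rewrite /edges_within/=; lia.
by apply: events_over_event; rewrite /edges_within/=; lia.
Qed.

Lemma reach_events_within i m n :
  (m <= n)%N -> events_over edge (edges_within i n) (reach i m).
Proof.
move=> mn; suff sub : edges_within i m `<=` edges_within i n.
  exact: (@events_over_sub _ _ _ edge _ _ sub _ (@reach_events_over i m)).
by move=> e []; rewrite /edges_within/=; lia.
Qed.

Lemma edges_within_sub i n : edges_within i n `<=` edges.
Proof. by move=> e []; rewrite /edges/=; lia. Qed.

Lemma edges_from_sub i : edges_from i `<=` edges.
Proof. by move=> e; rewrite /edges_from /edges/=; lia. Qed.

Lemma edge_indep : mutually_independent P edges edge.
Proof. exact: G_graph.1. Qed.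

Lemma measurable_reach i n : measurable (reach i n).
Proof.
exact: (events_over_measurable edge_indep (@edges_within_sub i n)
  (@reach_events_over i n)).
Qed.

Definition reach_upto i n : set T := \bigcap_(k < n.+1) reach i k.

Local Notation miss := (no_edge_probability p).

Lemma probability_no_edge_into i n :
  P (\bigcap_(k < n.+1) ~` edge (i + k%:Z, i + n.+1%:Z)) = (miss n.+1)%:E.
Proof.
rewrite (@probability_bigcap_setC _ _ _ P _ edge edges
  (fun k : nat => (i + k%:Z, i + n.+1%:Z)) (fun k => p (n.+1 - k)%N)).
(* The sources i, ..., i + n lie at distances n + 1 down to 1 from the target, so the product is
   reversed. *)
- congr EFin; rewrite big_nat_rev/= /no_edge_probability big_add1/=; apply: eq_big_nat => k kn.
  by congr (1 - p _); lia.
- exact: edge_indep.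
- by move=> k l /(congr1 fst)/=; lia.
- move=> k kn; split; first by rewrite /edges/=; lia.
  by rewrite G_graph.2/=; [congr (p _)%:E; lia|lia].
Qed.

Lemma probability_no_edge_from i m n :
  P (\bigcap_(k < n) ~` edge (i, i + (m + k).+1%:Z)) =
  (\prod_(0 <= k < n) (1 - p (m + k).+1))%:E.
Proof.
apply: (@probability_bigcap_setC _ _ _ P _ edge edges
  (fun k : nat => (i, i + (m + k).+1%:Z)) (fun k => p (m + k).+1)).
- exact: edge_indep.
- by move=> k l /(congr1 snd)/=; lia.
- move=> k kn; split; first by rewrite /edges/=; lia.
  by rewrite G_graph.2/=; [congr (p _)%:E; lia|lia].
Qed.

(** Since all earlier vertices are reached, any edge from one of them suffices. The new condition
    thus concerns only edges into i + n + 1, which are independent of the past. *)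
Lemma reach_uptoS i n : reach_upto i n.+1 =
  reach_upto i n `&` ~` \bigcap_(k < n.+1) ~` edge (i + k%:Z, i + n.+1%:Z).
Proof.
rewrite [LHS]bigcap_ltn_recr -/(reach_upto i n).
rewrite setC_bigcap reachE//; apply/seteqP; split=> w [rw [k kn]].
- by move=> [_ ek]; split=> //; exists k => //; rewrite setCK.
- by rewrite setCK => ek; split=> //; exists k => //; split=> //; exact: rw.
Qed.

Lemma probability_reach_upto i n :
  P (reach_upto i n) = (\prod_(0 <= k < n) (1 - miss k.+1))%:E.
Proof.
elim: n => [|n IHn].
  rewrite big_geq// /reach_upto bigcap_mkord big_ord1 reach0.
  exact: probability_setT.
pose into := [set e : int * int | e.1 < e.2 /\ e.2 = i + n.+1%:Z].
have into_sub : into `<=` edges by move=> e [].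
have noinE : events_over edge into
    (\bigcap_(k < n.+1) ~` edge (i + k%:Z, i + n.+1%:Z)).
  apply: events_over_bigcap => k /= kn.
  apply: events_overC.
  by apply: events_over_event; split=> //=; lia.
rewrite reach_uptoS (@events_over_disjoint_independent _ _ _ P _ edge edges
  edge_indep (edges_within i n) into) //.
- rewrite big_nat_recr//= EFinM -IHn EFinB -(probability_no_edge_into i).
  rewrite probability_setC//.
  exact: (events_over_measurable edge_indep into_sub noinE).
- exact: edges_within_sub.
- by rewrite -subset0 => e [[? +] [_ eE]]; rewrite eE; lia.
- apply: events_over_bigcap => k /= kn.
  exact: reach_events_within.
- exact: events_overC.
Qed.

(** * Missing infinitely many vertices, and restarting at a later vertex *)

Definition miss_infinitely i : set T :=
  \bigcap_N \bigcup_(n in [set n | (N <= n)%N]) ~` reach i n.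

(* [seqDU (late i) m] says that i + m is the first vertex reached after a miss,
   and [isolated i m] that i has no edge to a vertex beyond i + m. *)
Let late i m : set T := reach i m `&` \bigcup_(n < m) ~` reach i n.
Let isolated i m : set T := \bigcap_k ~` edge (i, i + (m + k).+1%:Z).

Lemma miss_infinitely_events_over i :
  events_over edge (edges_from i) (miss_infinitely i).
Proof.
apply: events_over_bigcap => N _; apply: events_over_bigcup => n _.
apply: events_overC.
apply: (@events_over_sub _ _ _ edge (edges_within i n)) (@reach_events_over i n).
by move=> e []; rewrite /edges_from/=; lia.
Qed.

Lemma late_events_over i m n :
  (m <= n)%N -> events_over edge (edges_within i n) (late i m).
Proof.
move=> mn; apply: events_overI; first exact: reach_events_within.
apply: events_over_bigcup => k /= km; apply: events_overC.
by apply: reach_events_within; lia.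
Qed.

Lemma seqDU_late_events_over i m :
  events_over edge (edges_within i m) (seqDU (late i) m).
Proof.
rewrite /seqDU -bigcup_mkord.
apply: events_overD; first exact: late_events_over.
by apply: events_over_bigcup => k /= km; apply: late_events_over; lia.
Qed.

(** Unless i is isolated beyond some point, an edge from i jumps over a missed vertex, so a first
    late vertex i + m exists. It inherits the misses, because i reaches whatever i + m reaches. *)
Lemma miss_infinitely_sub i :
  miss_infinitely i `<=` \bigcup_m isolated i m `|`
    \bigcup_m (seqDU (late i) m `&` miss_infinitely (i + m%:Z)).
Proof.
move=> w Mw; have [|noI] := pselect ((\bigcup_m isolated i m) w).
  by left.
right.
have [n _ nr] := Mw 0%N I.
have : ~ isolated i n w by move=> In; apply: noI; exists n.
move=> /existsNP[k /not_implyP[_ /contrapT ek]].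
have : (\bigcup_m late i m) w.
  (* The direct edge from i ends beyond the missed vertex i + n, so its endpoint is late. *)
  exists (n + k).+1 => //; split; last by exists n => //=; lia.
  apply/reachable_last_edge; first by lia.
  exists i; split=> //; first by lia.
  by exists [::]; rewrite /increasing_path/=.
rewrite seqDU_bigcup_eq => -[m _ lm]; exists m => //; split=> // N _.
(* Asking for a miss of i past [N + m] makes its offset from i + m at least [N]. *)
have [l /= Nl nl] := Mw (N + m)%N I.
exists (l - m)%N => /=; first by lia.
move=> rl; apply: nl; have -> : l = (m + (l - m))%N by lia.
by apply: reach_trans; split=> //; case: lm => -[].
Qed.

Lemma measurable_isolated i m : measurable (isolated i m).
Proof.
apply: bigcap_measurableType => k _; apply: measurableC.
by apply: edge_indep.1; rewrite /edges/=; lia.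
Qed.

(** * Estimates from the summability of q_k *)

Hypothesis p_range : forall j, (1 <= j)%N -> 0 <= p j < 1.
Hypothesis p1_range : 0 < p 1%N < 1.
Hypothesis p_sum :
  (\sum_(1 <= k <oo) (\prod_(1 <= j < k.+1) (1 - p j))%:E < +oo)%E.

Lemma no_edge_probability_gt0 k : 0 < miss k.
Proof.
rewrite /no_edge_probability big_add1; apply: prodr_gt0 => j _.
by have := @p_range j.+1 isT; lra.
Qed.

(** Here [p 1 > 0] enters: the first factor is already below 1. This makes every factor 1 - q_k of
    the infinite product positive. *)
Lemma no_edge_probability_lt1 k : miss k.+1 < 1.
Proof.
rewrite /no_edge_probability big_ltn//.
have p1 : \prod_(2 <= j < k.+2) (1 - p j) <= 1.
  rewrite big_add1; apply: prodr_ile1 => j _.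
  by have := @p_range j.+1 isT; lra.
have := p1_range; nra.
Qed.

(** The second factor is the probability in [probability_no_edge_from]; this form serves to bound
    [isolated i m]. *)
Lemma no_edge_probabilityD m n :
  miss (m + n) = miss m * \prod_(0 <= k < n) (1 - p (m + k).+1).
Proof.
elim: n => [|n IHn]; first by rewrite addn0 big_geq// mulr1.
rewrite addnS big_nat_recr//= mulrA -IHn.
by rewrite /no_edge_probability [LHS]big_nat_recr.
Qed.

Lemma no_edge_probability_bounded_series :
  exists M, forall n, \sum_(0 <= k < n) miss k.+1 <= M.
Proof.
move: p_sum; set S := (X in (X < _)%E) => S_lty.
have term0 k : (0 <= (miss k)%:E)%E by rewrite lee_fin ltW// no_edge_probability_gt0.
have S0 : (0 <= S)%E by apply: nneseries_ge0 => k _ _; exact: term0.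
exists (fine S) => n; rewrite -lee_fin fineK ?ge0_fin_numE// -sumEFin.
rewrite -(big_add1 _ _ 0%N n.+1 xpredT (fun k => (miss k)%:E)).
exact: nneseries_lim_ge.
Qed.

Lemma no_edge_probability_cvg0 : (fun k => miss k.+1) @ \oo --> 0.
Proof.
have [M SM] := no_edge_probability_bounded_series.
apply: cvg_series_cvg_0.
by apply: (bounded_series_cvg _ SM).2 => k; rewrite ltW// no_edge_probability_gt0.
Qed.

Lemma isolated_negligible i m : P (isolated i m) = 0%E.
Proof.
have Pfin : P (isolated i m) \is a fin_num.
  exact: fin_num_measure (measurable_isolated i m).
have Pge0 : 0 <= fine (P (isolated i m)) by rewrite fine_ge0.
(* Being isolated excludes the first [n] edges beyond i + m. The right side tends to 0 in [n] while
   [miss m > 0] stays fixed. *)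
have bound n : fine (P (isolated i m)) * miss m <= miss (m + n).
  rewrite no_edge_probabilityD mulrC ler_pM2l ?no_edge_probability_gt0//.
  rewrite -lee_fin fineK// -(probability_no_edge_from i).
  apply: le_measure; rewrite ?inE//; last by move=> w Iw k _; exact: Iw.
    exact: measurable_isolated.
  apply: bigcap_measurableType => k _; apply: measurableC.
  by apply: edge_indep.1; rewrite /edges/=; lia.
have : fine (P (isolated i m)) * miss m <= 0.
  apply: cvgr_to_ge no_edge_probability_cvg0 _.
  exists m => // k /= mk; have -> : k.+1 = (m + (k.+1 - m))%N by lia.
  exact: bound.
rewrite pmulr_lle0 ?no_edge_probability_gt0// => Ple0.
by rewrite -(fineK Pfin); congr EFin; apply/eqP; rewrite eq_le Ple0.
Qed.

Lemma reach_all_bounded_away :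
  exists2 c : R, 0 < c & forall i, (c%:E <= P (\bigcap_n reach i n))%E.
Proof.
have [M SM] := no_edge_probability_bounded_series.
have [|c c0 cP] := prod_one_minus_bounded_away _ SM.
  by move=> k; rewrite ltW ?no_edge_probability_gt0//= no_edge_probability_lt1.
exists c => // i.
have mU n : measurable (reach_upto i n).
  by apply: bigcap_measurableType => k _; exact: measurable_reach.
(* The events [reach_upto i n] decrease in [n], so continuity from above applies, and their
   probabilities do not depend on i. *)
have upto_reach : \bigcap_n reach i n = \bigcap_n reach_upto i n.
  apply/seteqP; split=> w rw n _; first by move=> k _; exact: rw.
  by apply: (rw n I) => /=.
rewrite upto_reach.
have := @nonincreasing_cvg_mu _ _ _ P (reach_upto i).
move=> /(_ _ mU (bigcap_measurableType _)) cvgP.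
apply: cvge_ge (cvgP _ _ _).
- by exists 0%N => // n _ /=; rewrite probability_reach_upto lee_fin.
- by rewrite (le_lt_trans (probability_le1 _ (mU 0%N)))// ltry.
- by move=> n _; exact: mU.
- move=> m n mn; apply/subsetPset => w rw k /= km; apply: rw => /=; lia.
Qed.

Lemma measurable_miss_infinitely i : measurable (miss_infinitely i).
Proof.
exact: (events_over_measurable edge_indep (@edges_from_sub i)
  (@miss_infinitely_events_over i)).
Qed.

Lemma measurable_seqDU_late i m : measurable (seqDU (late i) m).
Proof.
exact: (events_over_measurable edge_indep (@edges_within_sub i m)
  (@seqDU_late_events_over i m)).
Qed.

(** A late vertex presupposes a missed one, which is impossible when every vertex is reached. *)
Lemma late_le (c : R) i : (c%:E <= P (\bigcap_n reach i n))%E ->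
  (P (\bigcup_m late i m) <= (1 - c)%:E)%E.
Proof.
move=> cP.
have mR : measurable (\bigcap_n reach i n).
  by apply: bigcap_measurableType => k _; exact: measurable_reach.
apply: (@le_trans _ _ (P (~` \bigcap_n reach i n))).
  apply: le_measure; rewrite ?inE//; last 2 first.
  - exact: measurableC.
  - by move=> w [m _ [_ [n _ nr]]] rw; apply: nr; exact: rw.
  rewrite seqDU_bigcup_eq; apply: bigcupT_measurable => m.
  exact: measurable_seqDU_late.
by rewrite probability_setC// EFinB; apply: leeB.
Qed.

Lemma miss_infinitely_le (c : R) k i : 0 < c ->
  (forall i, (c%:E <= P (\bigcap_n reach i n))%E) ->
  (P (miss_infinitely i) <= ((1 - c) ^+ k)%:E)%E.
Proof.
move=> c0 cP; have c1 : 0 <= 1 - c.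
  rewrite subr_ge0 -lee_fin; apply: le_trans (cP 0) (probability_le1 _ _).
  by apply: bigcap_measurableType => n _; exact: measurable_reach.
(* The induction covers all i at once, since the restart moves to i + m. *)
elim: k i => [|k IHk] i.
  exact/probability_le1/measurable_miss_infinitely.
have mX m : measurable (seqDU (late i) m `&` miss_infinitely (i + m%:Z)).
  apply: measurableI; first exact: measurable_seqDU_late.
  exact: measurable_miss_infinitely.
have mI : measurable (\bigcup_m isolated i m).
  by apply: bigcupT_measurable => m; exact: measurable_isolated.
have PI : P (\bigcup_m isolated i m) = 0%E.
  apply/(negligibleP _ mI)/negligible_bigcup => m.
  by apply/negligibleP; [exact: measurable_isolated|exact: isolated_negligible].
have mUX : measurable (\bigcup_m (seqDU (late i) m `&`
    miss_infinitely (i + m%:Z))).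
  by apply: bigcupT_measurable => m; exact: mX.
apply: (@le_trans _ _ (P (\bigcup_m (seqDU (late i) m `&`
    miss_infinitely (i + m%:Z))))).
  rewrite -(measureU0 mUX mI PI) setUC.
  apply: le_measure; rewrite ?inE; last exact: miss_infinitely_sub.
    exact: measurable_miss_infinitely.
  exact: measurableU.
rewrite measure_bigcup//; last exact/trivIset_setIr/trivIset_seqDU.
(* For each m, independence factors the probability, and the induction hypothesis bounds the misses
   of i + m uniformly in m. *)
apply: (@le_trans _ _
  (\sum_(0 <= m <oo) ((1 - c) ^+ k)%:E * P (seqDU (late i) m))%E).
  under eq_eseriesl do rewrite in_setT.
  apply: lee_nneseries => // m _.
  rewrite [leLHS](_ : _ =
      (P (seqDU (late i) m) * P (miss_infinitely (i + m%:Z)))%E).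
    by rewrite muleC; apply: lee_wpmul2r => //; exact: IHk.
  apply: (@events_over_disjoint_independent _ _ _ P _ edge edges
    edge_indep (edges_within i m) (edges_from (i + m%:Z))).
  - exact: edges_within_sub.
  - exact: edges_from_sub.
  - by rewrite -subset0 => e [[_ +] +]; rewrite /edges_from/=; lia.
  - exact: seqDU_late_events_over.
  - exact: miss_infinitely_events_over.
rewrite nneseriesZl// exprSr EFinM.
apply: lee_wpmul2l; first by rewrite lee_fin exprn_ge0.
(* The disjoint events sum to the probability that a late vertex exists, which supplies the extra
   factor 1 - c. *)
apply: le_trans (late_le (cP i)); rewrite seqDU_bigcup_eq.
rewrite measure_bigcup//; last by move=> m _; exact: measurable_seqDU_late.
by under [leRHS]eq_eseriesl do rewrite in_setT.
Qed.

Lemma miss_infinitely_negligible i : P (miss_infinitely i) = 0%E.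
Proof.
have [c c0 cP] := reach_all_bounded_away.
have Pfin : P (miss_infinitely i) \is a fin_num.
  exact: fin_num_measure (measurable_miss_infinitely i).
have c1 : c <= 1.
  rewrite -lee_fin; apply: le_trans (cP 0) (probability_le1 _ _).
  by apply: bigcap_measurableType => n _; exact: measurable_reach.
have c_cvg : (fun k => (1 - c) ^+ k) @ \oo --> (0 : R).
  by apply: cvg_expr; rewrite ger0_norm; lra.
apply/eqP; rewrite eq_le measure_ge0 andbT -(fineK Pfin) lee_fin.
apply: cvgr_to_ge c_cvg _; exists 0%N => // k _ /=.
by rewrite -lee_fin fineK// miss_infinitely_le.
Qed.

End line_graph.

(** * Almost sure eventual reachability *)

Theorem mainTheorem9 (R : realType) (d : measure_display)
    (T : measurableType d) (P : probability T R) (p : nat -> R)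
    (G : T -> rel int)
    (p_range : forall j : nat, (1 <= j)%N -> 0 <= p j < 1)
    (p1_range : 0 < p 1%N < 1)
    (p_sum : (\sum_(1 <= k <oo) (\prod_(1 <= j < k.+1) (1 - p j))%:E < +oo)%E)
    (G_graph : random_line_graph P p G) :
  forall i : int,
    {ae P, forall w, exists N : int, forall j : int, N <= j ->
      exists s : seq int, increasing_path (G w) i j s}.
Proof.
move=> i; apply: (@negligibleS _ _ _ P (miss_infinitely G i)).
  move=> w /= nw N _; apply: contrapT => nN; apply: nw.
  (* If i misses nothing from offset [N] on, then i + N is the required threshold. *)
  exists (i + N%:Z) => j Nj; apply: contrapT => nr; apply: nN.
  exists `|j - i|%N => /=; first by lia.
  by rewrite /reach/=; have -> : i + `|j - i|%N%:Z = j by lia.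
apply/negligibleP; first exact: measurable_miss_infinitely G_graph _.
exact: (miss_infinitely_negligible G_graph p_range p1_range p_sum).
Qed.
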